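(* Let $p_1,\dots,p_k$ be distinct primes ($k\ge1$) and let $G=S_{p_1}\times\cdots\times S_{p_k}$ be a finite abelian group with $d(G)=2$, where each $S_{p_i}$ is a non-cyclic $p_i$-group with $|S_{p_i}|=p_i^{u_i}$. Then $$\Gamma(G)=\bigotimes_{i=1}^{k}\Gamma(S_{p_i}).$$ Moreover, $\Delta(G)$ is an $\alpha$-partite graph, where $\alpha=\prod_{i=1}^{k}(p_i+1)$ and each part has size $\prod_{i=1}^{k}\varphi(p_i^{u_i-1})$.
   Context: The generating graph $\Gamma(G)$ of a group $G$ is the simple graph with vertex set $G$ in which two distinct vertices $x,y$ are adjacent if and only if $\langle x,y\rangle=G$. $\Delta(G)$ is the subgraph of $\Gamma(G)$ induced by its non-isolated vertices. $d(G)$ is the minimum size of a generating set of $G$. $\varphi$ is the Euler totient function. The Kronecker product $\mathcal{G}_1\otimes\mathcal{G}_2$ of graphs has vertex set $V(\mathcal{G}_1)\times V(\mathcal{G}_2)$, with $(u_1,v_1)$ adjacent to $(u_2,v_2)$ if and only if $u_1u_2\in E(\mathcal{G}_1)$ and $v_1v_2\in E(\mathcal{G}_2)$. A graph is $\alpha$-partite if its vertex set is partitioned into $\alpha$ independent sets (the parts). *)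

(* Defs.v *)
From HB Require Import structures.
From mathcomp Require Import all_boot all_fingroup all_solvable.

Set Implicit Arguments.
Unset Strict Implicit.
Unset Printing Implicit Defensive.

Import GroupScope.

(* A simple graph whose vertices are the elements of a finite set, and whose
   edges are 2-element sets of vertices.  Since the well-formedness condition
   is boolean, two graphs are equal iff they have the same vertices and edges. *)
Record sgraph (T : finType) := SGraph {
  vertices : {set T};
  edges : {set {set T}};
  _ : [forall e in edges, (e \subset vertices) && (#|e| == 2)]
}.

Definition adjacent (T : finType) (D : sgraph T) (x y : T) : bool :=
  [set x; y] \in edges D.

Section OfRelation.

Variables (T : finType) (V : {set T}) (r : rel T).

Definition rel_edges : {set {set T}} :=
  [set e : {set T} | [exists x in V, exists y in V,
     [&& x != y, r x y & e == [set x; y]]]].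

Lemma rel_edges_simple :
  [forall e in rel_edges, (e \subset V) && (#|e| == 2)].
Proof.
apply/forall_inP=> e; rewrite inE.
case/exists_inP=> x Vx /exists_inP[y Vy /and3P[neq_xy _ /eqP->]].
by rewrite subUset !sub1set Vx Vy cards2 neq_xy.
Qed.

Definition graph_of_rel : sgraph T := SGraph rel_edges_simple.

Lemma graph_of_relP (r_sym : symmetric r) x y :
  adjacent graph_of_rel x y = [&& x \in V, y \in V, x != y & r x y].
Proof.
rewrite /adjacent inE; apply/exists_inP/and4P.
  case=> a Va /exists_inP[b Vb /and3P[neq_ab rab /eqP eq_xy]].
  have neq_xy : x != y.
    by move/(congr1 (fun A : {set T} => #|A|)): eq_xy; rewrite !cards2 neq_ab; case: eqP.
  have: x \in [set a; b] by rewrite -eq_xy set21.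
  have: y \in [set a; b] by rewrite -eq_xy set22.
  rewrite !inE => /orP[]/eqP ey /orP[]/eqP ex; subst x y;
    by rewrite ?eqxx // in neq_xy *; split; rewrite // r_sym.
case=> Vx Vy neq_xy rxy; exists x => //; apply/exists_inP; exists y => //.
by rewrite neq_xy rxy eqxx.
Qed.

End OfRelation.

Definition generating_graph (gT : finGroupType) (G : {set gT}) : sgraph gT :=
  graph_of_rel G (fun x y => <<[set x; y]>> == G).

(* As adjacency in each factor already implies [u i != v i], the distinctness
   condition built into [graph_of_rel] is only active when [I] is empty. *)
Definition kronecker_product (I : finType) (T : I -> finType)
    (D : forall i, sgraph (T i)) : sgraph {dffun forall i, T i} :=
  graph_of_rel (setXn (fun i => vertices (D i)))
    (fun u v => [forall i, adjacent (D i) (u i) (v i)]).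

Definition induced_subgraph (T : finType) (D : sgraph T) (W : {set T}) :
    sgraph T :=
  graph_of_rel (vertices D :&: W) (adjacent D).

Definition nonisolated (T : finType) (D : sgraph T) : {set T} :=
  [set x in vertices D | [exists y, adjacent D x y]].

Definition generating_graph_nonisolated (gT : finGroupType) (G : {set gT}) :
    sgraph gT :=
  induced_subgraph (generating_graph G) (nonisolated (generating_graph G)).

Definition independent (T : finType) (D : sgraph T) (A : {set T}) : bool :=
  [forall x in A, forall y in A, ~~ adjacent D x y].

Definition multipartition (T : finType) (D : sgraph T) (P : {set {set T}}) :
    bool :=
  partition P (vertices D) && [forall A in P, independent D A].

(* Main.v *)
(** Let Phi be the Frattini subgroup of a non-cyclic p-group S of rank 2.  Then
    S / Phi is elementary abelian of order p^2, and two elements generate S iff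
    their images in S / Phi are nontrivial and span distinct lines.  Hence the
    non-isolated vertices of the generating graph of S are those outside Phi,
    and the parts are the p + 1 classes of elements spanning the same line
    modulo Phi.  As the factors have coprime orders, two elements of the product
    generate it iff their components generate each factor, so products of parts
    partition the non-isolated vertices of the generating graph of G. *)
Require Import Defs.
From HB Require Import structures.
From mathcomp Require Import all_boot all_fingroup all_solvable.

Set Implicit Arguments.
Unset Strict Implicit.

Import GroupScope.

(** Induction along a duplicate-free enumeration of [I]: the next index is new, so its factor is
    coprime to the product of the others. *)
Lemma dvdn_prod_coprime (I : finType) (F : I -> nat) n :
    (forall i j, i != j -> coprime (F i) (F j)) -> (forall i, F i %| n) ->
  \prod_i F i %| n.
Proof.
move=> coF dvF.
elim: (index_enum I) (index_enum_uniq I) => [|i s IHs] /=.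
  by rewrite big_nil dvd1n.
case/andP=> nsi uniq_s; rewrite big_cons Gauss_dvd ?dvF ?IHs // big_seq.
apply: (big_ind (coprime (F i))) => [|a b|j sj]; first exact: coprimen1.
  by rewrite coprimeMr => -> ->.
by apply: coF; apply: contraNneq nsi => ->.
Qed.

(** * Partitions of a product set into boxes *)

Section PartitionProduct.

Variables (I : finType) (T : I -> finType).
Variables (D : forall i, {set T i}) (Q : forall i, {set {set T i}}).
Hypothesis partQ : forall i, partition (Q i) (D i).

Definition setXn_partition : {set {set {dffun forall i, T i}}} :=
  [set setXn (fun i => B i) | B : {dffun forall i, {set T i}} in setXn Q].

Lemma setXn_blocks_eq (B C : {dffun forall i, {set T i}}) x :
    B \in setXn Q -> C \in setXn Q ->
    x \in setXn (fun i => B i) -> x \in setXn (fun i => C i) ->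
  B = C.
Proof.
move=> /setXnP QB /setXnP QC /setXnP Bx /setXnP Cx; apply/ffunP=> i.
have [_ tiQ _] := and3P (partQ i).
by rewrite -(def_pblock tiQ (QB i) (Bx i)) (def_pblock tiQ (QC i) (Cx i)).
Qed.

Lemma setXn_block_neq0 (B : {dffun forall i, {set T i}}) :
  B \in setXn Q -> setXn (fun i => B i) != set0.
Proof.
move/setXnP=> QB; rewrite -card_gt0 cardsXn; apply: prodn_gt0 => i.
have [_ _ Q0] := and3P (partQ i).
by rewrite card_gt0; apply: contraNneq Q0 => <-; apply: QB.
Qed.

Lemma partition_setXn : partition setXn_partition (setXn D).
Proof.
apply/and3P; split.
- apply/eqP/setP=> x; apply/bigcupP/setXnP.
    case=> _ /imsetP[B /setXnP QB ->] /setXnP Bx i.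
    rewrite -(cover_partition (partQ i)); apply/bigcupP.
    by exists (B i); [apply: QB | apply: Bx].
  move=> Dx; have covx i : x i \in cover (Q i).
    by rewrite (cover_partition (partQ i)).
  (* The box whose sides are the blocks containing the coordinates of [x]. *)
  exists (setXn (fun i => [ffun j => pblock (Q j) (x j)] i)).
    by apply/imset_f/setXnP=> i; rewrite ffunE pblock_mem.
  by apply/setXnP=> i; rewrite ffunE mem_pblock.
- apply/trivIsetP=> _ _ /imsetP[B QB ->] /imsetP[C QC ->].
  apply: contraNT => /pred0Pn[x /andP[Bx Cx]].
  by rewrite (setXn_blocks_eq QB QC Bx Cx).
- by apply/imsetP=> -[B QB eq0]; have := setXn_block_neq0 QB; rewrite -eq0 eqxx.
Qed.

(** Boxes are nonempty and a point determines its block in each coordinate, so distinct families [B]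
    give distinct boxes. *)
Lemma card_setXn_partition : #|setXn_partition| = (\prod_i #|Q i|)%N.
Proof.
rewrite card_in_imset ?cardsXn // => B C QB QC eqBC.
have /set0Pn[x Bx] := setXn_block_neq0 QB.
by apply: (setXn_blocks_eq QB QC Bx); rewrite -eqBC.
Qed.

End PartitionProduct.

(** * Generating pairs and the Frattini quotient *)

Lemma eq_graph_of_rel (T : finType) (V : {set T}) (r r' : rel T) :
    {in V &, forall x y, x != y -> r x y = r' x y} ->
  graph_of_rel V r = graph_of_rel V r'.
Proof.
move=> eq_r; have eqE : rel_edges V r = rel_edges V r'.
  apply/setP=> e; rewrite !inE; apply: eq_existsb_in => x Vx.
  apply: eq_existsb_in => y Vy; case: eqVneq => //= neq_xy.
  by rewrite eq_r.
(* The well-formedness proofs inhabit a boolean equation, so equal edge sets suffice. *)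
rewrite /graph_of_rel; move: (rel_edges_simple _ r) (rel_edges_simple _ r').
by rewrite eqE => e1 e2; rewrite (bool_irrelevance e1 e2).
Qed.

Lemma generating_graph_adjacent (gT : finGroupType) (G : {group gT}) x y :
  adjacent (generating_graph G) x y = (x != y) && (<<[set x; y]>> == G).
Proof.
rewrite graph_of_relP => [|a b]; last by rewrite setUC.
apply/idP/idP => [/and4P[_ _ -> ->] // | /andP[-> /eqP defG]].
by rewrite -defG eqxx !mem_gen ?set21 ?set22.
Qed.


(** If [x = y] the pair generates a cyclic group, so distinctness is automatic. *)
Lemma generating_graph_noncyclic (gT : finGroupType) (G : {group gT}) x y :
  ~~ cyclic G -> adjacent (generating_graph G) x y = (<<[set x; y]>> == G).
Proof.
move=> ncycG; rewrite generating_graph_adjacent.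
case: eqVneq => //= <-; apply/esym; apply: contraNF ncycG => /eqP<-.
by rewrite setUid cycle_cyclic.
Qed.

(** Frattini elements are non-generators: if [X] together with ['Phi(G)] generates [G], then [X]
    alone does. *)
Lemma gen_Phi_quotient (gT : finGroupType) (G : {group gT}) (X : {set gT}) :
  X \subset G -> (<<X>> == G) = (<<X>> / 'Phi(G) == G / 'Phi(G)).
Proof.
move=> sXG; have nPhi := normal_norm (Phi_normal G).
apply/eqP/eqP=> [-> // | eqQ]; apply: Phi_nongen; rewrite -joing_idr.
apply/eqP; rewrite eqEsubset join_subG Phi_sub gen_subG sXG /=.
by rewrite norm_joinEr ?(subset_trans _ nPhi) ?gen_subG // -quotientSK ?eqQ.
Qed.

(** * Non-cyclic p-groups of rank 2 *)

Section PGroup.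

Variables (gT : finGroupType) (p : nat) (P : {group gT}).
Hypotheses (pP : p.-group P) (ncycP : ~~ cyclic P) (rankP : 'm(P) <= 2).

Local Notation Phi := 'Phi(P).

Lemma noncyclic_pgroup_prime : prime p.
Proof.
have ntP : P != 1%G by apply: contra ncycP => /eqP->; apply: cyclic1.
by have [] := pgroup_pdiv pP ntP.
Qed.
Let p_pr := noncyclic_pgroup_prime.

(** The rank bounds the order by [p ^ 2]; order 1 or [p] would make the quotient cyclic, and then
    [P] itself. *)
Lemma card_quotient_Phi : #|P / Phi| = (p ^ 2)%N.
Proof.
have abelQ := Phi_quotient_abelem pP.
have lelog : logn p #|P / Phi| <= 2.
  rewrite -rank_abelem // -grank_abelian ?(abelem_abelian abelQ) //.
  by rewrite (leq_trans _ rankP) // quotient_grank // normal_norm ?Phi_normal.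
have [n eqn] := p_natP (abelem_pgroup abelQ).
rewrite eqn pfactorK // in lelog *.
case: n lelog eqn => [|[|[|//]]] // _ eqn; case/negP: ncycP;
  apply: Phi_quotient_cyclic.
  by rewrite (card1_trivg eqn) cyclic1.
by apply: prime_cyclic; rewrite eqn expn1.
Qed.

Lemma order_coset_Phi x : x \in P :\: Phi -> #[coset Phi x] = p.
Proof.
case/setDP=> Px; have Nx := subsetP (normal_norm (Phi_normal P)) x Px.
move=> nPhix.
rewrite (abelem_order_p (Phi_quotient_abelem pP)) ?mem_quotient //.
by apply: contra nPhix => /eqP/coset_idr->.
Qed.

Lemma cycle_quotient_Phi x : <[coset Phi x]> == P / Phi = false.
Proof.
apply: contraNF ncycP => /eqP defQ; apply: Phi_quotient_cyclic.
by rewrite -defQ cycle_cyclic.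
Qed.

Lemma generating_graph_pgroup x y :
  adjacent (generating_graph P) x y =
  [&& x \in P :\: Phi, y \in P :\: Phi & <[coset Phi x]> != <[coset Phi y]>].
Proof.
have [sxy|nsxy] := boolP ([set x; y] \subset P); last first.
  rewrite generating_graph_adjacent !inE.
  have -> : (<<[set x; y]>> == P) = false.
    by apply: contraNF nsxy => /eqP<-; apply: subset_gen.
  rewrite andbF; apply/esym; apply: contraNF nsxy => /and3P[].
  by rewrite subUset !sub1set => /andP[_ ->] /andP[_ ->].
have [Px Py] : x \in P /\ y \in P.
  by move: sxy; rewrite subUset !sub1set => /andP[].
have nPhi := normal_norm (Phi_normal P).
have [Nx Ny] := (subsetP nPhi x Px, subsetP nPhi y Py).
rewrite generating_graph_adjacent gen_Phi_quotient //.
rewrite -joingE -joing_idl -joing_idr quotientY ?cycle_subG //.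
rewrite !quotient_cycle //.
apply/andP/and3P.
  case=> neq_xy /eqP eqQ.
  (* If [z] lay in [Phi], the image of [t] alone would generate the quotient. *)
  have notPhi z t : z \in P ->
      <[coset Phi z]> <*> <[coset Phi t]> = P / Phi -> z \in P :\: Phi.
    move=> Pz; rewrite inE Pz andbT => eqzt; apply/negP=> Phiz.
    have := cycle_quotient_Phi t.
    by rewrite -eqzt (coset_id Phiz) cycle1 joing1G eqxx.
  split; first exact: notPhi Px eqQ.
    by apply: notPhi Py _; rewrite joingC; apply: eqQ.
  apply: contraFneq (cycle_quotient_Phi x) => eqxy.
  by rewrite -eqQ -eqxy joingE setUid genGid.
case=> Dx Dy neqc; split; first by apply: contraNneq neqc => ->.
have sQ : <[coset Phi x]> <*> <[coset Phi y]> \subset P / Phi.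
  by rewrite join_subG !cycle_subG !mem_quotient.
rewrite eqEcard sQ card_quotient_Phi.
(* The join has order [p ^ m]. For [m = 1] both lines equal the join and so coincide; [m = 0]
   contradicts the order [p] of the image of [x]. *)
have := cardSg sQ; rewrite card_quotient_Phi.
case/(dvdn_pfactor _ _ p_pr)=> m; case: m => [|[|m]] lem eqm; last first.
- by rewrite eqm leq_pexp2l // prime_gt0.
- case/eqP: neqc.
  have /eqP-> : <[coset Phi x]> == <[coset Phi x]> <*> <[coset Phi y]>.
    by rewrite eqEcard joing_subl eqm expn1 -orderE order_coset_Phi /=.
  apply/esym/eqP.
  by rewrite eqEcard joing_subr eqm expn1 -orderE order_coset_Phi /=.
- have: #[coset Phi x] <= 1.
    by rewrite -(expn0 p) -eqm subset_leq_card ?joing_subl.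
  by rewrite order_coset_Phi // leqNgt prime_gt1.
Qed.

Lemma nonisolated_pgroup : nonisolated (generating_graph P) = P :\: Phi.
Proof.
apply/setP=> x; rewrite [LHS]inE /=; apply/andP/idP.
  by case=> _ /existsP[y]; rewrite generating_graph_pgroup => /and3P[].
move=> Dx; have [Px _] := setDP Dx; split=> //.
(* Any coset off the line spanned by [x] supplies a neighbour. *)
have: ~~ (P / Phi \subset <[coset Phi x]>).
  apply: contraFN (cycle_quotient_Phi x) => sQx.
  by rewrite eqEsubset sQx cycle_subG mem_quotient.
case/subsetPn=> _ /morphimP[y Ny Py ->] ncy; apply/existsP; exists y.
rewrite generating_graph_pgroup Dx inE Py andbT /=; apply/andP; split.
  by apply: contraNN ncy => Phiy; rewrite /= coset_id ?group1.
by apply: contraNneq ncy => ->; apply: cycle_id.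
Qed.

Definition Phi_parts : {set {set gT}} :=
  preim_partition (fun x => <[coset Phi x]>) (P :\: Phi).

Lemma Phi_parts_partition :
  partition Phi_parts (nonisolated (generating_graph P)).
Proof. by rewrite nonisolated_pgroup; apply: preim_partitionP. Qed.

Lemma Phi_parts_independent A x y :
  A \in Phi_parts -> x \in A -> y \in A -> ~~ adjacent (generating_graph P) x y.
Proof.
case/imsetP=> z Dz ->; rewrite !inE => /andP[_ /eqP eqx] /andP[_ /eqP eqy].
by rewrite generating_graph_pgroup -eqx -eqy eqxx !andbF.
Qed.

(** A part is the preimage of a line of order [p] with [Phi] removed, which leaves
    [#|Phi| * p - #|Phi|] elements. *)
Lemma card_Phi_parts_mem A : A \in Phi_parts -> #|A| = (#|Phi| * p.-1)%N.
Proof.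
case/imsetP=> z Dz ->; have [Pz nPhiz] := setDP Dz.
have nPhi := normal_norm (Phi_normal P).
have sMP : coset Phi @*^-1 <[coset Phi z]> \subset P.
  by rewrite sub_cosetpre_quo ?Phi_normal // cycle_subG mem_quotient.
have -> : [set y in P :\: Phi | <[coset Phi z]> == <[coset Phi y]>] =
    coset Phi @*^-1 <[coset Phi z]> :\: Phi.
  apply/setP=> y; rewrite in_set !in_setD.
  case: (boolP (y \in Phi)) => //= nPhiy.
  apply/andP/idP=> [[Py /eqP eqzy] | My].
    by rewrite mem_morphpre ?(subsetP nPhi) // eqzy cycle_id.
  have Py := subsetP sMP y My; split=> //.
  (* The image of [y] spans a subgroup of the line, and both have order [p]. *)
  rewrite eq_sym eqEcard cycle_subG; case/morphpreP: My => _ -> /=.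
  by rewrite -!orderE !order_coset_Phi // inE ?nPhiy ?nPhiz.
rewrite cardsD (setIidPr _) ?sub_cosetpre // card_cosetpre -orderE.
by rewrite order_coset_Phi // -subn1 mulnBr muln1.
Qed.

(** Double counting: parts of equal size [#|Phi| * p.-1] cover [P :\: Phi], of size
    [#|Phi| * (p ^ 2 - 1)]. *)
Lemma card_Phi_parts : #|Phi_parts| = p.+1.
Proof.
have p1 : 0 < p.-1 by rewrite -subn1 subn_gt0 prime_gt1.
have part_gt0 : 0 < #|Phi| * p.-1 by rewrite muln_gt0 cardG_gt0.
apply/eqP; rewrite -(eqn_pmul2r part_gt0).
rewrite -(card_uniform_partition card_Phi_parts_mem (preim_partitionP _ _)).
rewrite cardsD (setIidPr (Phi_sub P)) -(Lagrange (Phi_sub P)).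
rewrite -card_quotient ?normal_norm ?Phi_normal // card_quotient_Phi.
rewrite mulnCA -[X in _ - X]muln1 -mulnBr eqn_pmul2l ?cardG_gt0 //.
by rewrite -subn1 -[p.+1]addn1 mulnC -subn_sqr exp1n.
Qed.

Lemma totient_card_Phi u : #|P| = (p ^ u)%N ->
  totient (p ^ (u - 1)) = (#|Phi| * p.-1)%N.
Proof.
move=> cardP; have p0 := prime_gt0 p_pr.
have := Lagrange (Phi_sub P).
rewrite -card_quotient ?normal_norm ?Phi_normal //.
(* Exponents 0 and 1 would make [P] cyclic, so [u - 1] is not truncated and [#|Phi|] is [p] to the
   power [u - 2]. *)
rewrite card_quotient_Phi cardP; case: u cardP => [|[|u]] cardP eqc.
- by case/negP: ncycP; rewrite (card1_trivg cardP) cyclic1.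
- by case/negP: ncycP; rewrite prime_cyclic // cardP expn1.
have p2_gt0 : 0 < p ^ 2 by rewrite expn_gt0 p0.
have -> : #|Phi| = (p ^ u)%N.
  by apply/eqP; rewrite -(eqn_pmul2r p2_gt0) eqc -expnD addn2.
by rewrite subn1 totient_pfactor // mulnC.
Qed.

End PGroup.

(** * Products of groups of pairwise coprime orders *)

Section Product.

Variables (I : finType) (gT : I -> finGroupType) (S : forall i, {group gT i}).
Hypothesis coS : forall i j : I, i != j -> coprime #|S i| #|S j|.

Local Notation prodS := (setXn_group S).

Lemma morphim_dffun_pair i (x y : {dffun forall i, gT i}) :
  dffun_morphism gT i @* <<[set x; y]>> = <<[set x i; y i]>>.
Proof.
by rewrite morphim_gen ?subsetT // morphimEsub ?subsetT // imsetU1 imset_set1.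
Qed.

(* The subgroup generated by [x] and [y] surjects onto every factor, so its
   order is divisible by all the coprime orders [#|S i|]. *)
Lemma gen_pair_setXn (x y : {dffun forall i, gT i}) :
  (<<[set x; y]>> == setXn S) = [forall i, <<[set x i; y i]>> == S i].
Proof.
apply/eqP/forallP=> [eqS i | eqS].
  by rewrite -morphim_dffun_pair eqS morphim_dffunXn.
have Sxy i : (x i \in S i) && (y i \in S i).
  by rewrite -(eqP (eqS i)) !mem_gen ?set21 ?set22.
apply/eqP; rewrite eqEcard; apply/andP; split.
  rewrite (_ : setXn S = prodS) // gen_subG subUset !sub1set.
  by apply/andP; split; apply/setXnP=> i; have /andP[] := Sxy i.
rewrite dvdn_leq ?cardG_gt0 // cardsXn dvdn_prod_coprime // => i.
by rewrite -(eqP (eqS i)) -morphim_dffun_pair dvdn_morphim.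
Qed.

Hypothesis ncycS : forall i, ~~ cyclic (S i).

Lemma generating_graph_setXn :
  generating_graph prodS = kronecker_product (fun i => generating_graph (S i)).
Proof.
apply: eq_graph_of_rel => x y _ _ _; rewrite gen_pair_setXn.
by apply: eq_forallb => i; rewrite generating_graph_noncyclic.
Qed.

Variable i0 : I.

(** The index [i0] excludes the empty product, where the right side holds vacuously at [x = y];
    adjacency at [i0] forces [x != y]. *)
Lemma adjacent_setXn (x y : {dffun forall i, gT i}) :
  adjacent (generating_graph prodS) x y =
  [forall i, adjacent (generating_graph (S i)) (x i) (y i)].
Proof.
rewrite generating_graph_adjacent gen_pair_setXn.
apply/andP/forallP=> [[_ /forallP eqS] i | adjS].
  by rewrite generating_graph_noncyclic.
split; last by apply/forallP=> i; rewrite -generating_graph_noncyclic.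
by apply: contraTneq (adjS i0) => ->; rewrite generating_graph_adjacent eqxx.
Qed.

Lemma nonisolated_setXn :
  nonisolated (generating_graph prodS) =
  setXn (fun i => nonisolated (generating_graph (S i))).
Proof.
apply/setP=> x; rewrite inE /=; apply/andP/setXnP.
  case=> /setXnP Sx /existsP[y]; rewrite adjacent_setXn => /forallP adjxy i.
  by rewrite inE /= Sx; apply/existsP; exists (y i).
move=> Dx; have adjx i : exists y, adjacent (generating_graph (S i)) (x i) y.
  by have := Dx i; rewrite inE => /andP[_ /existsP].
split; first by apply/setXnP=> i; have := Dx i; rewrite inE => /andP[].
(* A neighbour is assembled from neighbours chosen in every factor. *)
apply/existsP; exists [ffun i => xchoose (adjx i)].
by rewrite adjacent_setXn; apply/forallP=> i; rewrite ffunE (xchooseP (adjx i)).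
Qed.

End Product.

Unset Implicit Arguments.
Set Strict Implicit.

Theorem theorem5p3 (k : nat) (p u : 'I_k -> nat)
    (gT : 'I_k -> finGroupType) (S : forall i : 'I_k, {group gT i})
    (G : {group {dffun forall i : 'I_k, gT i}})
    (k_ge1 : (1 <= k)%N)
    (p_inj : injective p)
    (p_prime : forall i : 'I_k, prime (p i))
    (G_def : G = setXn S :> {set {dffun forall i : 'I_k, gT i}})
    (G_abelian : abelian G)
    (G_rank : 'm(G) = 2)
    (S_pgroup : forall i : 'I_k, (p i).-group (S i))
    (S_noncyclic : forall i : 'I_k, ~~ cyclic (S i))
    (S_card : forall i : 'I_k, #|S i| = (p i ^ u i)%N) :
  generating_graph G = kronecker_product (fun i => generating_graph (S i)) /\
  exists P : {set {set {dffun forall i : 'I_k, gT i}}},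
    [/\ multipartition (generating_graph_nonisolated G) P,
        #|P| = (\prod_(i < k) (p i + 1))%N
      & forall A, A \in P -> #|A| = (\prod_(i < k) totient (p i ^ (u i - 1)))%N].
Proof.
have coS i j : i != j -> coprime #|S i| #|S j|.
  move=> neq_ij; rewrite !S_card coprimeXl ?coprimeXr // prime_coprime //.
  by rewrite dvdn_prime2 // (inj_eq p_inj).
have defG : G = setXn_group S by apply: val_inj.
(* [S i] is the image of [G] under a projection, which cannot raise the rank. *)
have rankS i : 'm(S i) <= 2.
  have := @morphim_grank _ _ _ (dffun_morphism gT i) (setXn_group S)
    (subsetT _).
  by rewrite morphim_dffunXn /= -G_def G_rank.
pose i0 := Ordinal k_ge1.
pose Q i := Phi_parts (S i).
have partQ i : partition (Q i) (nonisolated (generating_graph (S i))).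
  exact: Phi_parts_partition (S_pgroup i) (S_noncyclic i) (rankS i).
rewrite defG; split; first exact: generating_graph_setXn.
exists (setXn_partition Q); split.
- have vertD : vertices (generating_graph_nonisolated (setXn_group S)) =
      setXn (fun i => nonisolated (generating_graph (S i))).
    rewrite -(nonisolated_setXn coS S_noncyclic i0) /=.
    by apply/setIidPr/subsetP=> x; rewrite inE => /andP[].
  rewrite /multipartition vertD partition_setXn //=.
  apply/forall_inP=> _ /imsetP[B /setXnP QB ->].
  apply/forall_inP=> x /setXnP Bx; apply/forall_inP=> y /setXnP By.
  rewrite graph_of_relP => [|a b]; last by rewrite /adjacent setUC.
  apply/negP=> /and4P[_ _ _]; rewrite (adjacent_setXn coS S_noncyclic i0).
  (* Two points of one box already fail to be adjacent in coordinate [i0], where they share a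
     part. *)
  move/forallP/(_ i0); apply/negP.
  exact: (Phi_parts_independent (S_pgroup i0) (S_noncyclic i0) (rankS i0)
    (QB i0)).
- rewrite (card_setXn_partition partQ); apply: eq_bigr => i _.
  by rewrite (card_Phi_parts (S_pgroup i) (S_noncyclic i) (rankS i)) addn1.
move=> _ /imsetP[B /setXnP QB ->]; rewrite cardsXn; apply: eq_bigr => i _.
rewrite (totient_card_Phi (S_pgroup i) (S_noncyclic i) (rankS i) (S_card i)).
by rewrite (card_Phi_parts_mem (S_pgroup i) (QB i)).
Qed.
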